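(* For every instance of the One-Shot Combinatorial Exchange, every agent $i\in N$ and every monotonic valuation $\vartheta_i:I^m\to I$ over individual trades (i.e. $\vartheta_i(\lambda')\ge\vartheta_i(\lambda)$ whenever $\lambda'\ge\lambda$ componentwise), $M_{ce}\models IR_i$; that is, individual rationality $IR_i$ holds at every stage $t$ of every path $\delta$ of $M_{ce}$.
   Context: **Bid-trees.** $N=\{1,\dots,n\}$ is the set of agents, $G=\{1,\dots,m\}$ the set of goods ($n,m\ge 1$), $I=\{z\in\mathbb{Z}: z_{\min}\le z\le z_{\max}\}$ with $z_{\min}\le 0\le z_{\max}$ and $n,m\in I$; $I_+=I\cap\{0,1,2,\dots\}$. A bid-tree is either a leaf $\langle q,j,v\rangle$ with $q,v\in I$, $j\in G$, or $IC_x^y(\bar\beta,v)$ with $\bar\beta=(\beta_1,\dots,\beta_s)$ a nonempty finite list of bid-trees, $x,y\in I_+$, $v\in I$; the $\beta_k$ are its children. $Node(T)$ is the set of all nodes (occurrences of sub-bids, including the root) of $T$, $Leaf(T)$ the set of leaf nodes, $Child(\beta)$ the children of $\beta$. $v(\beta)$ is the value $v$ written at node $\beta$; $q(\beta,j)=q$ if $\beta=\langle q,j,v\rangle$, and $q(\beta,j)=0$ otherwise; for a non-leaf $\beta=IC_x^y(\cdot)$ put $x_\beta=x$, $y_\beta=y$. For $\lambda\in I^m$, $valid(T,\lambda)$ is the set of $sat:Node(T)\to\{0,1\}$ with $x_\beta\, sat(\beta)\le\sum_{\beta'\in Child(\beta)}sat(\beta')\le y_\beta\, sat(\beta)$ for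 all non-leaf $\beta$, and $\sum_{\beta\in Leaf(T)}q(\beta,j)sat(\beta)\le\lambda_j$ for all $j\in G$. If $valid(T,\lambda)\neq\emptyset$, the value is $v(T,\lambda)=\max_{sat\in valid(T,\lambda)}\sum_{\beta\in Node(T)}v(\beta)sat(\beta)$. Standing assumption: only bid-trees with all these values in $I$ are considered. Two bid-trees are equivalent if they have the same value (or are both undefined) at each $\lambda\in I^m$. $noop=\langle 0,g,0\rangle$ for a fixed $g\in G$. **Winner determination.** For $T=(T_1,\dots,T_n)$ and an allocation $X=(x_{i,j})\in I_+^{nm}$, $WD(T,X)$ maximizes $\sum_{i}\sum_{\beta\in Node(T_i)}v(\beta)sat_i(\beta)$ over $\Lambda=(\lambda_{i,j})\in I^{nm}$ and $sat=(sat_1,\dots,sat_n)$ subject to $\lambda_{i,j}+x_{i,j}\ge0$ for all $i,j$; $\sum_i\lambda_{i,j}=0$ for all $j$; $sat_i\in valid(T_i,\lambda_i)$ for all $i$. $\Lambda(T,X)=(\lambda_{i,j}(T,X))$ is the $\Lambda$-part of an optimal solution, ties broken by a fixed total order on $I^{nm}$. **Paths.** For a tuple $(W,\bar w,T,L,U)$ with states $W$, initial state $\bar w$, terminal states $T\subseteq W$, legality relation $L\subseteq W\times N\times\mathcal{A}$ ($L(w,i)=\{a:(w,i,a)\in L\}$) and update function $U:W\times\mathcal{A}^n\to W$, a path $\delta$ is an infinite sequence $\bar w=w_0\xrightarrow{d_1}w_1\xrightarrow{d_2}\cdots$ such that for all $t\ge1$: $w_t\ne w_0$; $d_t(i)\in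 L(w_{t-1},i)$ for all $i\in N$; $w_t=U(w_{t-1},d_t)$; and $w_{t-1}\in T$ implies $w_t=w_{t-1}$. Write $\delta[t]=w_t$, $\theta_i(\delta,t)=d_{t+1}(i)$ (agent $i$'s action at stage $t$), and $\delta[0,t]$ for the finite prefix $\bar w\xrightarrow{d_1}\cdots\xrightarrow{d_t}w_t$. **Instance and model $M_{ce}$.** An instance is given by $I,n,m$, initial holdings $\mathsf{x}_{i,j}\in I_+$, and a finite set $\mathcal{A}\ni noop$ of pairwise non-equivalent bid-trees ($I$ being large enough to contain the total supply of goods). $W$ is the set of tuples $\langle b,(x_{i,j}),(\lambda_{i,j}),(p_i)\rangle$ with $b\in\{0,1\}$, $x_{i,j}\in I_+$, $\lambda_{i,j},p_i\in I$; $\bar w=\langle1,(\mathsf{x}_{i,j}),(0),(0)\rangle$; $T=W\setminus\{\bar w\}$; $L=\{(w,i,noop):i\in N,w\in T\}\cup\{(\bar w,i,\beta):i\in N,\beta\in\mathcal{A}\}$; $U(\bar w,d)=\langle0,(x'_{i,j}),(\lambda'_{i,j}),(p'_i)\rangle$ with $\lambda'_{i,j}=\lambda_{i,j}(d,(\mathsf{x}_{i,j}))$, $x'_{i,j}=\mathsf{x}_{i,j}+\lambda'_{i,j}$, $p'_i=v(d(i),(\lambda'_{i,1},\dots,\lambda'_{i,m}))$; $U(w,d)=w$ for $w\ne\bar w$. In a state $\langle b,(x_{i,j}),(\lambda_{i,j}),(p_i)\rangle$: $trade_i$ has value $(\lambda_{i,1},\dots,\lambda_{i,m})$ and $payment_i$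 has value $p_i$. **Individual rationality.** The utility of agent $i$ in a state with trade $\lambda_i$ and payment $p_i$ is $u_i=\vartheta_i(\lambda_i)-p_i$. $IR_i$ holds at stage $t$ of $\delta$ iff there is a path $\delta'$ of the model with $\delta'[0,t]=\delta[0,t]$, $\theta_r(\delta',t)=\theta_r(\delta,t)$ for all $r\in N\setminus\{i\}$, and such that for each $x\in I$: if the utility of $i$ in $\delta'[t]$ equals $x$, then the utility of $i$ in $\delta'[t+1]$ is $\ge x$. *)

(* Defs.v *)
From HB Require Import structures.
From mathcomp Require Import all_boot all_order all_algebra.
From mathcomp Require Import zify.

Set Implicit Arguments.
Unset Strict Implicit.
Unset Printing Implicit Defensive.

Import Order.TTheory GRing.Theory Num.Theory.
Local Open Scope ring_scope.

(* The integer interval [a, b], as a finite subtype of int. *)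
Record zint (a b : int) := Zint {zint_val :> int; zintP : a <= zint_val <= b}.

HB.instance Definition _ (a b : int) := [isSub for @zint_val a b].
HB.instance Definition _ (a b : int) := [Countable of zint a b by <:].

Section ZintFinite.
Variables a b : int.

Definition zint_code (z : zint a b) : 'I_`|b - a|.+1 := inord `|(z : int) - a|.
Definition zint_decode (k : 'I_`|b - a|.+1) : option (zint a b) :=
  insub (a + k%:Z).

Lemma zint_codeK : pcancel zint_code zint_decode.
Proof.
move=> z; have /andP[az zb] := zintP z.
rewrite /zint_decode /zint_code inordK; last by lia.
by rewrite -[RHS](valK z) /=; congr insub; lia.
Qed.

HB.instance Definition _ : isFinite (zint a b) := PCanIsFinite zint_codeK.
End ZintFinite.

Record params := Params {
  zmin : int;
  zmax : int;
  nagents : nat;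
  ngoods : nat;
  zmin_le0 : zmin <= 0;
  zmax_ge0 : 0 <= zmax;
  nagents_gt0 : (0 < nagents)%N;
  ngoods_gt0 : (0 < ngoods)%N;
  nagents_in : zmin <= nagents%:Z <= zmax;
  ngoods_in : zmin <= ngoods%:Z <= zmax
}.

Notation agent P := 'I_(nagents P).
Notation good P := 'I_(ngoods P).
Notation bval P := (zint (zmin P) (zmax P)).
(* As zmin <= 0, the nonnegative elements of [zmin, zmax] form [0, zmax]. *)
Notation bnat P := (zint 0 (zmax P)).
Notation itrade P := 'rV[bval P]_(ngoods P).
Notation trade P := 'M[bval P]_(nagents P, ngoods P).
Notation holding P := 'M[bnat P]_(nagents P, ngoods P).

Lemma bval0_proof (P : params) : zmin P <= 0 <= zmax P.
Proof. by rewrite zmin_le0 zmax_ge0. Qed.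
Definition bval0 (P : params) : bval P := Zint (bval0_proof P).

(* The children of IC x y b bs v are the nonempty list b :: bs. *)
Inductive bidtree (P : params) :=
| Leaf of bval P & good P & bval P
| IC of bnat P & bnat P & bidtree P & seq (bidtree P) & bval P.

Section BidtreeChoice.
Variable P : params.

Definition btag : Type :=
  ((bval P * good P * bval P) + (bnat P * bnat P * bval P))%type.

Fixpoint bt_encode (T : bidtree P) : GenTree.tree btag :=
  match T with
  | Leaf q j v => GenTree.Leaf (inl (q, j, v))
  | IC x y b bs v =>
      GenTree.Node 0 [:: GenTree.Leaf (inr (x, y, v)), bt_encode b
                       & map bt_encode bs]
  end.

Fixpoint bt_decode (t : GenTree.tree btag) : option (bidtree P) :=
  match t with
  | GenTree.Leaf (inl (q, j, v)) => Some (Leaf q j v)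
  | GenTree.Node _ (GenTree.Leaf (inr (x, y, v)) :: t1 :: ts) =>
      omap (fun b => IC x y b (pmap bt_decode ts) v) (bt_decode t1)
  | _ => None
  end.

Lemma bt_encodeK : pcancel bt_encode bt_decode.
Proof.
rewrite /pcancel; fix IH 1; case=> [q j v|x y b bs v] //=; rewrite IH /=.
congr (Some (IC _ _ _ _ _)).
by elim: bs => //= c cs IHcs; rewrite IH /= IHcs.
Qed.

HB.instance Definition _ := Countable.copy (bidtree P) (pcan_type bt_encodeK).
End BidtreeChoice.

Section Bids.
Variable P : params.
Implicit Types (T b : bidtree P) (l : itrade P).

Definition bvalue b : int := match b with Leaf _ _ v => v | IC _ _ _ _ v => v end.

Definition is_leaf b : bool := if b is Leaf _ _ _ then true else false.

Definition bquantity b (j : good P) : int :=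
  if b is Leaf q j' _ then (if j' == j then q : int else 0) else 0.

(* A node is an occurrence of a sub-bid: its address (the list of child indices
   leading to it from the root) paired with the sub-bid found there. *)
Fixpoint nodes T : seq (seq nat * bidtree P) :=
  ([::], T) ::
  if T is IC _ _ b bs _ then
    [seq (0%N :: p.1, p.2) | p <- nodes b] ++
    (fix go (k : nat) (cs : seq (bidtree P)) :=
       if cs is c :: cs' then
         [seq (k :: p.1, p.2) | p <- nodes c] ++ go k.+1 cs'
       else [::]) 1%N bs
  else [::].

Definition Node T := seq_sub (nodes T).
Definition node_addr T (u : Node T) : seq nat := (val u).1.
Definition node_bid T (u : Node T) : bidtree P := (val u).2.

Definition is_child T (u c : Node T) : bool :=
  prefix (node_addr u) (node_addr c) &&
  (size (node_addr c) == (size (node_addr u)).+1).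

Notation satfun T := {ffun Node T -> bool}.

Definition valid T l (sat : satfun T) : bool :=
  [forall u : Node T,
     if node_bid u is IC x y _ _ _ then
       (x : int) * (sat u)%:Z <= \sum_(c | is_child u c) (sat c)%:Z
         <= (y : int) * (sat u)%:Z
     else true] &&
  [forall j : good P,
     \sum_(u : Node T | is_leaf (node_bid u)) bquantity (node_bid u) j * (sat u)%:Z
       <= (l ord0 j : int)].

Definition weight T (sat : satfun T) : int :=
  \sum_(u : Node T) bvalue (node_bid u) * (sat u)%:Z.

(* None when no node assignment is valid at l. *)
Definition value T l : option int :=
  omap (fun s0 => weight [arg max_(s > s0 | valid l s) weight s]%O)
       [pick s : satfun T | valid l s].

Definition value_bounded T : Prop :=
  forall l v, value T l = Some v -> zmin P <= v <= zmax P.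

Definition equivalent T1 T2 : Prop := forall l, value T1 l = value T2 l.

Definition noop_bid (g : good P) : bidtree P := Leaf (bval0 P) g (bval0 P).

Definition satprofile (T : agent P -> bidtree P) :=
  {dffun forall i : agent P, satfun (T i)}.

Definition wd_feasible (T : agent P -> bidtree P) (X : holding P)
    (L : trade P) (sat : satprofile T) : bool :=
  [&& [forall i, forall j, 0 <= (L i j : int) + (X i j : int)],
      [forall j, \sum_(i < nagents P) (L i j : int) == 0]
    & [forall i, valid (row i L) (sat i)]].

Definition wd_objective (T : agent P -> bidtree P) (sat : satprofile T) : int :=
  \sum_(i < nagents P) weight (sat i).

Definition wd_optimal (T : agent P -> bidtree P) (X : holding P)
    (L : trade P) : bool :=
  [exists sat : satprofile T, wd_feasible X L sat &&
     [forall L' : trade P, forall sat' : satprofile T,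
        wd_feasible X L' sat' ==> (wd_objective sat' <= wd_objective sat)]].

Record total_order (A : Type) (le : rel A) : Prop := TotalOrder {
  to_total : total le;
  to_anti : antisymmetric le;
  to_trans : transitive le
}.

(* L is the trade part of an optimal solution that the tie-breaking order le
   ranks first. *)
Definition wd_selected (le : rel (trade P)) (T : agent P -> bidtree P)
    (X : holding P) (L : trade P) : bool :=
  wd_optimal T X L && [forall L', wd_optimal T X L' ==> le L L'].

Lemma wd_optimal_ex (T : agent P -> bidtree P) (X : holding P) : exists L, wd_optimal T X L.
Proof.
pose F := [pred s : trade P * satprofile T | wd_feasible X s.1 s.2].
pose s0 : trade P * satprofile T :=
  (const_mx (bval0 P), [ffun i => [ffun=> false]]).
have Fs0 : F s0.
  apply/and3P; split.
  - apply/forallP=> i; apply/forallP=> j; rewrite mxE add0r.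
    by case/andP: (zintP (X i j)).
  - by apply/forallP=> j; rewrite big1 // => i _; rewrite mxE.
  apply/forallP=> i; rewrite ffunE; apply/andP; split.
    apply/forallP=> u; case: (node_bid u) => // x y _ _ _.
    rewrite ffunE !mulr0 big1 ?lexx // => c _.
    by rewrite ffunE.
  apply/forallP=> j; rewrite !mxE big1 // => u _.
  by rewrite ffunE mulr0.
case: (@arg_maxP _ _ _ s0 F (fun s => wd_objective s.2) Fs0) => -[L s] /= Fs maxs.
exists L; apply/existsP; exists s; rewrite Fs /=.
apply/forallP=> L'; apply/forallP=> s'; apply/implyP=> Fs'.
exact: (maxs (L', s')).
Qed.

Lemma wd_selected_ex le (T : agent P -> bidtree P) (X : holding P) :
  total_order le -> exists L, wd_selected le T X L.
Proof.
case=> le_tot _ le_tr; have [L0 oL0] := wd_optimal_ex T X.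
have le_refl : reflexive le by move=> x; have := le_tot x x; rewrite orbb.
have [L oL minL] := extremumP id le_refl le_tr le_tot oL0.
exists L; rewrite /wd_selected oL /=; apply/forallP=> L'.
by apply/implyP; apply: minL.
Qed.

Lemma wd_selectedP le (T : agent P -> bidtree P) (X : holding P) L : wd_selected le T X L ->
  [/\ forall i j, 0 <= (L i j : int) + (X i j : int),
      forall j, \sum_(i < nagents P) (L i j : int) = 0
    & forall i, exists sat : satfun (T i), valid (row i L) sat].
Proof.
case/andP=> /existsP[sat /andP[/and3P[fX fL fsat] _]] _; split.
- by move=> i j; move/forallP/(_ i)/forallP: fX.
- by move=> j; apply/eqP; move/forallP: fL.
by move=> i; exists (sat i); move/forallP: fsat.
Qed.

End Bids.

(* The tie-breaking order on trades and the good of noop are arbitrary fixed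
   choices, hence part of the instance. The supply condition is per good. *)
Record exchange (P : params) := Exchange {
  holding0 : holding P;
  supply_in : forall j, \sum_(i < nagents P) (holding0 i j : int) <= zmax P;
  bids : seq (bidtree P);
  bids_bounded : forall b, b \in bids -> value_bounded b;
  bids_nonequiv : forall b1 b2,
    b1 \in bids -> b2 \in bids -> b1 != b2 -> ~ equivalent b1 b2;
  noop_good : good P;
  noop_in : noop_bid noop_good \in bids;
  tiebreak : rel (trade P);
  tiebreakP : total_order tiebreak
}.

Record model (n : nat) := Model {
  state : Type;
  action : Type;
  init : state;
  terminal : state -> Prop;
  legal : state -> 'I_n -> action -> Prop;
  update : state -> {ffun 'I_n -> action} -> state
}.

(* steps d t is the joint action labelling the transition from stage t to
   stage t + 1, so that steps d t i is the action of i at stage t. *)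
Record mpath n (M : model n) := MPath {
  stages :> nat -> state M;
  steps : nat -> {ffun 'I_n -> action M};
  path_init : stages 0 = init M;
  path_noreturn : forall t, (1 <= t)%N -> stages t <> stages 0;
  path_legal : forall t i, legal (stages t) i (steps t i);
  path_update : forall t, stages t.+1 = update (stages t) (steps t);
  path_terminal : forall t, terminal (stages t) -> stages t.+1 = stages t
}.

Definition same_prefix n (M : model n) (d d' : mpath M) (t : nat) : Prop :=
  (forall s, (s <= t)%N -> d' s = d s) /\
  (forall s, (s < t)%N -> steps d' s = steps d s).

Section OneShot.
Variables (P : params) (E : exchange P).

Definition ce_action := seq_sub (bids E).
Definition ce_noop : ce_action := SeqSub (noop_in E).

Definition ce_state : Type :=
  (bool * holding P * trade P * {ffun agent P -> bval P})%type.
HB.instance Definition _ := Finite.on ce_state.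

Definition state_trade (w : ce_state) : trade P := w.1.2.
Definition state_payment (w : ce_state) : {ffun agent P -> bval P} := w.2.

Definition ce_init : ce_state :=
  (true, holding0 E, const_mx (bval0 P), [ffun=> bval0 P]).

Definition ce_terminal (w : ce_state) : Prop := w <> ce_init.

Definition ce_legal (w : ce_state) (i : agent P) (a : ce_action) : Prop :=
  (ce_terminal w /\ a = ce_noop) \/ w = ce_init.

Section NewState.
Variable d : {ffun agent P -> ce_action}.

Definition bid_profile (i : agent P) : bidtree P := val (d i).

Definition new_trade : trade P :=
  xchoose (wd_selected_ex bid_profile (holding0 E) (tiebreakP E)).

Let new_tradeP := wd_selectedP
  (xchooseP (wd_selected_ex bid_profile (holding0 E) (tiebreakP E))).

Lemma new_holding_in i j :
  0 <= (holding0 E i j : int) + (new_trade i j : int) <= zmax P.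
Proof.
case: new_tradeP; rewrite -/new_trade => ge0 sum0 _.
rewrite addrC ge0 /=; apply: le_trans (supply_in E j).
have -> : \sum_k (holding0 E k j : int)
        = \sum_k ((new_trade k j : int) + (holding0 E k j : int)).
  by rewrite big_split /= sum0 add0r.
by rewrite (bigD1 i) //= lerDl; apply: sumr_ge0 => k _.
Qed.

Definition new_holding : holding P := \matrix_(i, j) Zint (new_holding_in i j).

Lemma new_payment_ex i :
  exists p : bval P, value (bid_profile i) (row i new_trade) == Some (p : int).
Proof.
case: new_tradeP => _ _ /(_ i)[sat]; rewrite -/new_trade => vsat.
case v: (value (bid_profile i) (row i new_trade)) => [z|].
  have zP : zmin P <= z <= zmax P.
    by apply: (bids_bounded (valP (d i)) (l := row i new_trade)).
  by exists (Zint zP).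
by move: v; rewrite /value; case: pickP => // /(_ sat); rewrite vsat.
Qed.

(* The payment of i is the value of its bid at its own new trade. *)
Definition new_payment : {ffun agent P -> bval P} :=
  [ffun i => xchoose (new_payment_ex i)].

End NewState.

Definition ce_update (w : ce_state) (d : {ffun agent P -> ce_action}) : ce_state :=
  if w == ce_init then (false, new_holding d, new_trade d, new_payment d) else w.

Definition Mce : model (nagents P) :=
  Model ce_init ce_terminal ce_legal ce_update.

Definition utility (theta : itrade P -> bval P) (i : agent P) (w : state Mce) : int :=
  (theta (row i (state_trade w)) : int) - (state_payment w i : int).

Definition IR (theta : itrade P -> bval P) (i : agent P)
    (d : mpath Mce) (t : nat) : Prop :=
  exists d' : mpath Mce,
    [/\ same_prefix d d' t,
        forall r, r != i -> steps d' t r = steps d t r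
      & forall x : bval P, utility theta i (d' t) = (x : int) ->
          (x : int) <= utility theta i (d' t.+1)].

End OneShot.

Definition monotonic (P : params) (theta : itrade P -> bval P) : Prop :=
  forall l l' : itrade P, (forall j, (l ord0 j : int) <= (l' ord0 j : int)) ->
    (theta l : int) <= (theta l' : int).

(* Main.v *)
(** After the first round every state is terminal, so there is nothing to show.
    In the initial state agent i bids noop: since noop supplies nothing, free
    disposal forces its trade to be nonnegative in every good, while its
    payment is 0. By monotonicity its utility is at least that of the zero
    trade at zero payment, which is its initial utility. *)
Require Import Defs.
From mathcomp Require Import all_boot all_order all_algebra.

Set Implicit Arguments.
Unset Strict Implicit.
Unset Printing Implicit Defensive.

Import Order.TTheory GRing.Theory Num.Theory.
Local Open Scope ring_scope.

Section Noop.
Variables (P : params) (g : good P).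

Lemma node_bid_noop (u : Node (noop_bid g)) : node_bid u = noop_bid g.
Proof.
by have := valP u; rewrite inE /node_bid => /eqP ->.
Qed.

(** The only node of [noop_bid g] is a leaf of quantity 0, so the left side of the supply constraint
    for [j] vanishes and [l ord0 j] bounds it from above. *)
Lemma valid_noop_ge0 (l : itrade P) (sat : {ffun Node (noop_bid g) -> bool}) j :
  valid l sat -> 0 <= (l ord0 j : int).
Proof.
case/andP=> _ /forallP/(_ j); rewrite big1 // => u _.
by rewrite node_bid_noop /=; case: eqP => _; rewrite mul0r.
Qed.

Lemma value_noop (l : itrade P) v : value (noop_bid g) l = Some v -> v = 0.
Proof.
rewrite /value; case: pickP => //= s _ [<-].
by rewrite /weight big1 // => u _; rewrite node_bid_noop mul0r.
Qed.

End Noop.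

Section NoopBidder.
Variables (P : params) (E : exchange P) (i : agent P).
Variable a : {ffun agent P -> ce_action E}.
Hypothesis ai : a i = ce_noop E.

(** The selected trade is feasible, so its row [i] admits a valid assignment for the bid of [i],
    which is noop. *)
Lemma new_trade_noop_ge0 j : 0 <= (new_trade a i j : int).
Proof.
have bi : bid_profile a i = noop_bid (noop_good E) by rewrite /bid_profile ai.
have [_ _ /(_ i)] := wd_selectedP
  (xchooseP (wd_selected_ex (bid_profile a) (holding0 E) (tiebreakP E))).
rewrite -/(new_trade a) bi => -[sat /(@valid_noop_ge0 _ _ _ _ j)].
by rewrite mxE.
Qed.

Lemma new_payment_noop : new_payment a i = 0 :> int.
Proof.
rewrite ffunE; have /eqP := xchooseP (new_payment_ex a i).
by rewrite {1}/bid_profile ai; apply: value_noop.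
Qed.

End NoopBidder.

Section FirstStep.
Variables (P : params) (E : exchange P).
Variable a : {ffun agent P -> ce_action E}.

(** The deviating play: joint action [a] once, then noop by everyone in a state that no longer
    changes. *)
Definition first_step_stages (t : nat) : state (Mce E) :=
  if t is 0 then ce_init E else ce_update (ce_init E) a.

Definition first_step_steps (t : nat) : {ffun agent P -> action (Mce E)} :=
  if t is 0 then a else [ffun=> ce_noop E].

(** The update turns the boolean flag from [true] to [false]. *)
Lemma ce_update_init_neq : ce_update (ce_init E) a <> ce_init E.
Proof. by rewrite /ce_update eqxx. Qed.

Lemma ce_update_terminal (w : ce_state P) (c : {ffun agent P -> ce_action E}) :
  ce_terminal E w -> ce_update w c = w.
Proof. by move=> /eqP/negPf tw; rewrite /ce_update tw. Qed.

Lemma first_step_noreturn t :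
  (1 <= t)%N -> first_step_stages t <> first_step_stages 0.
Proof. by case: t => // t _; apply: ce_update_init_neq. Qed.

Lemma first_step_legal t r :
  legal (first_step_stages t) r (first_step_steps t r).
Proof.
case: t => [|t]; first by right.
by left; split; [apply: ce_update_init_neq | rewrite ffunE].
Qed.

Lemma first_step_update t :
  first_step_stages t.+1 = update (first_step_stages t) (first_step_steps t).
Proof.
case: t => [//|t]; symmetry.
exact: (ce_update_terminal _ ce_update_init_neq).
Qed.

Lemma first_step_terminal t :
  terminal (first_step_stages t) -> first_step_stages t.+1 = first_step_stages t.
(* Stage 0 is the initial state, hence not terminal; all later stages coincide. *)
Proof. by case: t => // /(_ erefl). Qed.

Definition first_step_path : mpath (Mce E) :=
  @MPath _ (Mce E) first_step_stages first_step_steps erefl first_step_noreturn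
    first_step_legal first_step_update first_step_terminal.

End FirstStep.

Lemma utility_noop_ge (P : params) (E : exchange P) (i : agent P)
    (theta : itrade P -> bval P) (a : {ffun agent P -> ce_action E}) :
  monotonic theta -> a i = ce_noop E ->
  utility (E := E) theta i (ce_init E)
    <= utility (E := E) theta i (ce_update (ce_init E) a).
Proof.
move=> theta_mono ai; rewrite /utility /state_trade /state_payment.
(* Both payments are 0, which leaves a comparison of [theta] at the zero trade and at the new
   one. *)
rewrite /ce_update eqxx /= ffunE (new_payment_noop ai) /= !subr0.
by apply: theta_mono => j; rewrite !mxE /=; apply: new_trade_noop_ge0.
Qed.

Theorem theorem2 (P : params) (E : exchange P) (i : agent P)
    (theta : itrade P -> bval P) (theta_mono : monotonic theta) :
  forall (d : mpath (Mce E)) (t : nat), IR theta i d t.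
Proof.
move=> d [|t].
  (* Only [i] deviates; the prefix up to stage 0 contains no action, so it is preserved. *)
  pose a := [ffun r => if r == i then ce_noop E else steps d 0 r].
  exists (first_step_path a); split.
  - by split=> [[|s] // _|//]; rewrite (path_init d).
  - by move=> r /negPf ri; rewrite /= ffunE ri.
  - by move=> x <-; apply: utility_noop_ge => //; rewrite ffunE eqxx.
(* The path is its own witness: it never returns to the initial state, so stage [t.+1] is terminal
   and the utility stays constant. *)
exists d; split=> // x <-.
rewrite (path_terminal (t := t.+1)) //.
by have := @path_noreturn _ _ d t.+1 isT; rewrite (path_init d).
Qed.
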